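(* Suppose $\{X_{\alpha}, f_{\alpha\beta}, D\}$ is an inverse limit system with non-empty compact Hausdorff factor spaces $X_\alpha$ ($\alpha\in D$), upper semi-continuous bonding functions $f_{\alpha\beta}: X_\beta \to 2^{X_\alpha}$ ($\alpha\preceq\beta$ in $D$) and a totally ordered index set $D$. Then $\varprojlim \mathbf{f}$ is cordial if and only if, for all $\alpha,\beta\in D$ with $\alpha\preceq\beta$, $f_{\alpha\beta}$ is surjective.
   Context: For a non-empty compact Hausdorff space $X$, $2^X$ denotes the set of non-empty compact subsets of $X$. For non-empty compact Hausdorff spaces $X,Y$, a function $f:X\to 2^Y$ is upper semi-continuous (u.s.c.) if for all $x\in X$ and every open $V\subseteq Y$ containing $f(x)$ there is an open $U\subseteq X$ containing $x$ with $f(u)\subseteq V$ for each $u\in U$ (equivalently, its graph $\{(x,y)\in X\times Y \mid y\in f(x)\}$ is closed). $f$ is surjective if for every $y\in Y$ the set $f^{-1}(y)=\{x\in X\mid y\in f(x)\}$ is non-empty. For u.s.c. $f:X\to 2^Y$ and $g:Y\to 2^Z$, $(g\circ f)(x)=\{z\in Z\mid \exists y\in Y \text{ with } y\in f(x) \text{ and } z\in g(y)\}$. A totally ordered index set is a set $D$ with a reflexive, transitive, antisymmetric and total relation $\preceq$. An inverse limit system $\{X_\alpha,f_{\alpha\beta},D\}$ consists of compact Hausdorff spaces $X_\alpha$ and u.s.c. functions $f_{\alpha\beta}:X_\beta\to 2^{X_\alpha}$ for $\alpha\preceq\beta$ in $D$, where $f_{\alpha\alpha}$ is the identity on $X_\alpha$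 (i.e. $f_{\alpha\alpha}(x)=\{x\}$), such that the collection $\mathbf{f}=\{f_{\alpha\beta}\mid\alpha\preceq\beta\in D\}$ is exact: $f_{\alpha\beta}\circ f_{\beta\eta}=f_{\alpha\eta}$ for all $\alpha\preceq\beta\preceq\eta$ in $D$. The inverse limit is $\varprojlim\mathbf{f}=\{\mathbf{x}\in\prod_{\alpha\in D}X_\alpha\mid x_\alpha\in f_{\alpha\beta}(x_\beta)\ \forall\,\alpha\preceq\beta\in D\}$. Whenever a finite subset $\{\beta_1,\ldots,\beta_n\}$ of $D$ is written, it is understood that $\beta_i\preceq\beta_j$ iff $i\le j$. For such a subset, $G(\beta_1,\ldots,\beta_n)=\{(x_{\beta_1},\ldots,x_{\beta_n})\in\prod_{1\le i\le n}X_{\beta_i}\mid x_{\beta_i}\in f_{\beta_i\beta_j}(x_{\beta_j})\text{ for }1\le i\le j\le n\}$. For $B\subseteq D$, $\pi_B$ is the projection $\prod_{\alpha\in D}X_\alpha\to\prod_{\alpha\in B}X_\alpha$. The inverse limit $\varprojlim\mathbf{f}$ is called cordial if for each finite subset $\{\beta_1,\ldots,\beta_n\}$ of $D$, $\pi_{\{\beta_1,\ldots,\beta_n\}}(\varprojlim\mathbf{f})=G(\beta_1,\ldots,\beta_n)$. *)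

(* Defs.v *)
From mathcomp Require Import all_boot all_order.
From mathcomp Require Import boolp classical_sets topology.

Set Implicit Arguments.
Unset Strict Implicit.
Unset Printing Implicit Defensive.

Local Open Scope classical_set_scope.
Local Open Scope order_scope.

Record hyperspace (Y : topologicalType) := Hyperspace {
  hset :> set Y;
  hset_nonempty : hset !=set0;
  hset_compact : compact hset
}.

Section SetValued.
Context {X Y Z : topologicalType}.

Definition upper_semicontinuous (f : X -> hyperspace Y) : Prop :=
  forall (x : X) (V : set Y), open V -> f x `<=` V ->
    exists U : set X, [/\ open U, U x & forall u, U u -> f u `<=` V].

Definition sv_preimage (f : X -> hyperspace Y) (y : Y) : set X :=
  [set x | hset (f x) y].

Definition sv_surjective (f : X -> hyperspace Y) : Prop :=
  forall y : Y, sv_preimage f y !=set0.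

(* The values are plain sets: that they are again compact is a consequence
   of upper semicontinuity. *)
Definition sv_comp (g : Y -> hyperspace Z) (f : X -> hyperspace Y) :
    X -> set Z :=
  fun x => [set z | exists y, hset (f x) y /\ hset (g y) z].

End SetValued.

Section InverseLimit.
Context {d : Order.disp_t} {D : orderType d} {X : D -> topologicalType}.
Variable f : forall a b : D, a <= b -> X b -> hyperspace (X a).

Definition identity_on_diagonal : Prop :=
  forall (a : D) (aa : a <= a) (x : X a), hset (f aa x) = [set x].

Definition exact_family : Prop :=
  forall (a b c : D) (ab : a <= b) (bc : b <= c) (ac : a <= c) (x : X c),
    sv_comp (f ab) (f bc) x = hset (f ac x).

Definition inverse_limit : set (forall a, X a) :=
  [set x | forall (a b : D) (ab : a <= b), hset (f ab (x b)) (x a)].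

(* A finite subset of [D] is given by its increasing enumeration
   [beta : 'I_n -> D]; the product of the corresponding factors is indexed
   by ['I_n]. *)
Definition increasing_enum (n : nat) (beta : 'I_n -> D) : Prop :=
  forall i j : 'I_n, beta i <= beta j <-> (i <= j)%N.

Definition finite_graph (n : nat) (beta : 'I_n -> D)
    (hb : increasing_enum beta) : set (forall i : 'I_n, X (beta i)) :=
  [set x | forall (i j : 'I_n) (ij : (i <= j)%N),
             hset (f (proj2 (hb i j) ij) (x j)) (x i)].

Definition finite_proj (n : nat) (beta : 'I_n -> D) (x : forall a, X a) :
    forall i : 'I_n, X (beta i) :=
  fun i => x (beta i).

Definition cordial : Prop :=
  forall (n : nat) (beta : 'I_n -> D) (hb : increasing_enum beta),
    finite_proj beta @` inverse_limit = finite_graph hb.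

End InverseLimit.

(* Main.v *)
Require Import Defs.
From mathcomp Require Import all_boot all_order.
From mathcomp Require Import boolp classical_sets topology.

Import Order.TTheory.

Local Open Scope classical_set_scope.
Local Open Scope order_scope.

(** For cordiality, a point of a finite graph is extended one index at a time:
    to a new index [c] lying between consecutive indices [m < c < M], exactness
    [f m M = f m c o f c M] provides a value; above all indices, surjectivity
    does; below all of them, non-emptiness of the values does. So the sets of
    points of the product satisfying finitely many of the constraints and
    extending the given point form a filter base. By Tychonoff it has a cluster
    point, which satisfies all the constraints because bonding functions have
    closed graphs. *)

(** Each fibre of [h] has at most one point, so the prescribed values cannot conflict; [t0] fills
    the indices outside the image. *)
Lemma extend_along_inj (I : Type) (J : eqType) (T : J -> Type) (h : I -> J)
    (t0 : forall j, T j) (y : forall i, T (h i)) :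
  injective h -> exists x : forall j, T j, forall i, x (h i) = y i.
Proof.
move=> h_inj.
(* Quantifying over every proof [e] lets [erefl] later recover [y i] without a cast. *)
have pick : forall j, exists v : T j, forall i (e : h i = j),
    ecast j (T j) e (y i) = v.
  move=> j; have [[i <-]|noi] := pselect (exists i, h i = j).
    by exists (y i) => k e; have ki := h_inj _ _ e; subst k; rewrite eq_axiomK.
  by exists (t0 j) => i e; case: noi; exists i.
by exists (fun j => sval (cid (pick j))) => i; rewrite -(svalP (cid (pick (h i))) i erefl).
Qed.

(** The relation is left abstract to serve twice: for the nearest index below a new one and, with
    the reversed order, for the nearest above. *)
Lemma seq_extremum (T : eqType) (e : rel T) (P : pred T) (s : seq T) :
  total e -> transitive e ->
  (forall a, a \in s -> ~~ P a) \/
  (exists m, [/\ m \in s, P m & forall a, a \in s -> P a -> e a m]).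
Proof.
move=> e_total e_trans; elim: s => [|c s IH]; first by left.
have [Pc|nPc] := boolP (P c); last first.
  case: IH => [none|[m [ms Pm mmax]]]; [left|right].
    by move=> a; rewrite inE => /predU1P[->|/none].
  exists m; split=> [||a]; rewrite ?inE ?ms ?orbT//.
  by case/predU1P => [->|]; [rewrite (negPf nPc)|exact: mmax].
have ecc : e c c by have := e_total c c; rewrite orbb.
right; case: IH => [none|[m [ms Pm mmax]]].
  exists c; split=> [||a]; rewrite ?mem_head// inE => /predU1P[->//|/none].
  by move/negPf ->.
have [cm|mc] := orP (e_total c m).
  exists m; split=> [||a]; rewrite ?inE ?ms ?orbT//.
  by case/predU1P => [->|/mmax].
exists c; split=> [||a]; rewrite ?mem_head// inE => /predU1P[->//|as_ Pa].
exact: e_trans (mmax _ as_ Pa) mc.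
Qed.

(** This is closedness of the graph. Regularity of [Y] gives a neighbourhood [V] of [y] whose
    closure misses [f x]; semicontinuity then keeps nearby values outside that closure. *)
Lemma usc_graph_separation (X Y : topologicalType) (f : X -> hyperspace Y)
    (x : X) (y : Y) :
  compact [set: Y] -> hausdorff_space Y -> upper_semicontinuous f ->
  ~ hset (f x) y ->
  exists U V, [/\ nbhs x U, nbhs y V & forall u v, U u -> V v -> ~ hset (f u) v].
Proof.
move=> Yc Yh f_usc nfxy.
have fx_closed : closed (f x) := compact_closed Yh (@hset_compact _ (f x)).
have ny : nbhs y (~` hset (f x))%classic by apply: open_nbhs_nbhs; split=> //; exact: closed_openC.
have [V yV clV] := compact_regular Yh Yc filterT ny.
have [||U [Uo Ux Uf]] := f_usc x (~` closure V)%classic.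
- exact/closed_openC/closed_closure.
- by move=> z fz /clV.
exists U, V; split=> //; first exact: open_nbhs_nbhs.
by move=> u v /Uf /(_ v) + Vv fuv => /(_ fuv); apply; exact: subset_closure.
Qed.

Section Threads.
Context (d : Order.disp_t) (D : orderType d) (X : D -> topologicalType).
Context (f : forall a b : D, a <= b -> X b -> hyperspace (X a)).
Hypothesis X_nonempty : forall a : D, [set: X a] !=set0.
Hypothesis f_id : identity_on_diagonal f.
Hypothesis f_exact : exact_family f.
Hypothesis f_surj : forall (a b : D) (ab : a <= b), sv_surjective (f a b ab).

(** Using a total family avoids dependent partial functions; coordinates outside [s] are junk and
    may be overwritten. *)
Definition partial_thread (s : seq D) (x : forall a, X a) : Prop :=
  forall (a b : D) (ab : a <= b), a \in s -> b \in s -> hset (f a b ab (x b)) (x a).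

Lemma exact_trans (a b c : D) (ab : a <= b) (bc : b <= c) (ac : a <= c)
    (x : X a) (y : X b) (z : X c) :
  hset (f a b ab y) x -> hset (f b c bc z) y -> hset (f a c ac z) x.
Proof. by move=> xy yz; rewrite -(f_exact _ _ _ ab bc); exists y. Qed.

Lemma exists_compatible_value (s : seq D) (x : forall a, X a) (c : D) :
  partial_thread s x ->
  exists v : X c,
    (forall a (ac : a <= c), a \in s -> hset (f a c ac v) (x a)) /\
    (forall b (cb : c <= b), b \in s -> hset (f c b cb (x b)) v).
Proof.
move=> xs.
have ge_total : total (>=%O : rel D) by move=> a b; exact: le_total.
have ge_trans : transitive (>=%O : rel D) by move=> a b e ba ea; exact: le_trans ea ba.
(* By exactness, the constraint between [c] and its nearest neighbour in [s] on either side implies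
   all the others on that side. *)
have below m (mc : m <= c) (v : X c) : m \in s ->
    (forall a, a \in s -> a <= c -> a <= m) -> hset (f m c mc v) (x m) ->
    forall a (ac : a <= c), a \in s -> hset (f a c ac v) (x a).
  move=> ms mmax vm a ac as_; have am := mmax a as_ ac.
  exact: exact_trans (xs _ _ am as_ ms) vm.
have above M (cM : c <= M) (v : X c) : M \in s ->
    (forall b, b \in s -> c <= b -> M <= b) -> hset (f c M cM (x M)) v ->
    forall b (cb : c <= b), b \in s -> hset (f c b cb (x b)) v.
  move=> Ms Mmin vM b cb bs; have Mb := Mmin b bs cb.
  exact: exact_trans vM (xs _ _ Mb Ms bs).
have [nolow|[m [ms mc mmax]]] :=
    seq_extremum D <=%O (fun a => a <= c) s le_total le_trans;
  have [noup|[M [Ms cM Mmin]]] :=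
    seq_extremum D >=%O (fun b => c <= b) s ge_total ge_trans.
- have [v _] := X_nonempty c; exists v; split.
  + by move=> a ac /nolow; rewrite ac.
  + by move=> b cb /noup; rewrite cb.
- have [v vM] := @hset_nonempty _ (f c M cM (x M)); exists v; split.
  + by move=> a ac /nolow; rewrite ac.
  + exact: above vM.
- have [v vm] := f_surj m c mc (x m); exists v; split.
  + exact: below vm.
  + by move=> b cb /noup; rewrite cb.
- have mM := le_trans mc cM.
  have := xs m M mM ms Ms.
  rewrite -(f_exact _ _ _ mc cM mM) => -[v [vM vm]]; exists v; split.
  + exact: below vm.
  + exact: above vM.
Qed.

Lemma partial_thread_cons (s : seq D) (x : forall a, X a) (c : D) :
  partial_thread s x ->
  exists2 x', partial_thread (c :: s) x' & {in s, forall a, x' a = x a}.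
Proof.
move=> xs; have [cs|cNs] := boolP (c \in s).
  exists x => // a b ab; rewrite !inE => as_ bs; apply: xs.
    by case/predU1P: as_ => [->|].
  by case/predU1P: bs => [->|].
have [v [low up]] := exists_compatible_value s x c xs.
have off a : a \in s -> dfwith x v a = x a.
  by move=> as_; rewrite dfwith_out//; apply: contraNneq cNs => ->.
exists (dfwith x v) => // a b; rewrite !inE => ab as_ bs; move: ab.
(* When both indices are [c] the constraint is the diagonal one; the mixed cases are the
   compatibility of [v]. *)
case/predU1P: as_ => [->|as_]; case/predU1P: bs => [->|bs] ab.
- by rewrite f_id.
- by rewrite dfwith_in off//; exact: up.
- by rewrite dfwith_in off//; exact: low.
- by rewrite !off//; exact: xs.
Qed.

Lemma partial_thread_cat (s t : seq D) (x : forall a, X a) :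
  partial_thread s x ->
  exists2 x', partial_thread (t ++ s) x' & {in s, forall a, x' a = x a}.
Proof.
move=> xs; elim: t => [|c t [x' x'ts x'x]]; first by exists x.
have [x'' x''P x''x'] := partial_thread_cons _ _ c x'ts.
by exists x'' => // a as_; rewrite x''x' ?x'x// mem_cat as_ orbT.
Qed.

Hypothesis X_compact : forall a : D, compact [set: X a].
Hypothesis X_hausdorff : forall a : D, hausdorff_space (X a).
Hypothesis f_usc :
  forall (a b : D) (ab : a <= b), upper_semicontinuous (f a b ab).

Lemma partial_thread_extends (s : seq D) (x : forall a, X a) :
  partial_thread s x ->
  exists2 p, inverse_limit f p & {in s, forall a, p a = x a}.
Proof.
move=> xs.
(* These sets form the filter base: [K (t ++ t')] lies in both [K t] and [K t'], and extending [x]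
   from [s] to [t ++ s] shows that each is inhabited. *)
pose K t : set (prod_topology X) :=
  [set z | partial_thread t z /\ {in s, forall a, z a = x a}].
have sub_thread t t' z : {subset t <= t'} -> partial_thread t' z ->
    partial_thread t z.
  by move=> tt' zt' a b ab /tt' ? /tt' ?; exact: zt'.
have K_filter : Filter (filter_from setT K).
  apply: filter_fromT_filter; first by exists [::].
  move=> t t'; exists (t ++ t') => z [zt zx]; split; split=> //.
    by apply: sub_thread zt => a; rewrite mem_cat => ->.
  by apply: sub_thread zt => a; rewrite mem_cat => ->; rewrite orbT.
have K_proper : ProperFilter (filter_from setT K).
  apply: filter_from_proper => t _.
  have [z zts zx] := partial_thread_cat s t x xs; exists z; split=> //.
  by apply: sub_thread zts => a; rewrite mem_cat => ->.
have [|p [_ p_cluster]] := tychonoff X_compact (F := filter_from setT K).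
  by apply: filterS filterT => z _ a.
have meets t W : nbhs p W -> exists2 z, K t z & W z.
  by move=> /(p_cluster _ _ (ex_intro2 _ _ t I (@subset_refl _ _)))[z []]; exists z.
exists p => [a b ab|a as_].
  (* A violated constraint would persist on a neighbourhood of [p], yet that neighbourhood meets [K
     [:: a; b]], where the constraint holds. *)
  apply: contrapT => nfp.
  have [U [V [pU pV UV]]] := usc_graph_separation _ _ _ _ _
    (X_compact a) (X_hausdorff a) (f_usc a b ab) nfp.
  have [|z [zt _] [zU zV]] := meets [:: a; b]
      (mathcomp_extra.proj b @^-1` U `&` mathcomp_extra.proj a @^-1` V)%classic.
    by apply: filterI; apply: proj_continuous.
  by apply: UV zU zV _; apply: zt; rewrite !inE eqxx ?orbT.
(* Every point of the base has coordinate [x a] at [a], so [x a] lies in each neighbourhood of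
   [p a]. *)
apply: X_hausdorff => A B pA xB.
have [|z [_ zx] zA] := meets [::] (mathcomp_extra.proj a @^-1` A).
  exact: proj_continuous.
by exists (z a); split=> //; rewrite zx//; exact: nbhs_singleton.
Qed.

End Threads.

(** One-element subsets suffice: the graph over a single index is the whole factor, so some thread
    passes through [y], and its coordinate at [b] is a preimage. *)
Lemma cordial_surjective (d : Order.disp_t) (D : orderType d)
    (X : D -> topologicalType)
    (f : forall a b : D, a <= b -> X b -> hyperspace (X a)) :
  identity_on_diagonal f -> cordial f ->
  forall (a b : D) (ab : a <= b), sv_surjective (f a b ab).
Proof.
move=> f_id f_cordial a b ab y.
have inc : increasing_enum (fun _ : 'I_1 => a).
  by move=> i j; rewrite !ord1 lexx.
have : finite_graph f inc (fun _ => y) by move=> i j ij; rewrite f_id.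
rewrite -f_cordial => -[x xlim xy]; exists (x b).
have <- : x a = y := congr1 (fun z : 'I_1 -> X a => z ord0) xy.
exact: xlim.
Qed.

Theorem theorem3p2 (d : Order.disp_t) (D : orderType d)
    (X : D -> topologicalType)
    (f : forall a b : D, a <= b -> X b -> hyperspace (X a))
    (X_nonempty : forall a : D, [set: X a] !=set0)
    (X_compact : forall a : D, compact [set: X a])
    (X_hausdorff : forall a : D, hausdorff_space (X a))
    (f_usc : forall (a b : D) (ab : a <= b), upper_semicontinuous (f a b ab))
    (f_id : identity_on_diagonal f)
    (f_exact : exact_family f) :
  cordial f <-> (forall (a b : D) (ab : a <= b), sv_surjective (f a b ab)).
Proof.
split=> [|f_surj n beta beta_inc]; first exact: cordial_surjective.
apply/seteqP; split=> [_ [x xlim <-] i j ij|y yG]; first exact: xlim.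
have beta_inj : injective beta.
  move=> i j ij; apply/val_inj/anti_leq/andP.
  by split; apply/beta_inc; rewrite ij.
have [x xy] := extend_along_inj _ _ X beta (fun a => sval (cid (X_nonempty a))) y beta_inj.
have xs : partial_thread d D X f (codom beta) x.
  move=> a b ab /codomP[i ai] /codomP[j bj]; subst a b; rewrite !xy.
  have ij := proj1 (beta_inc i j) ab.
  (* The graph uses the order proof supplied by [beta_inc], which must be identified with [ab]. *)
  by rewrite (bool_irrelevance ab (proj2 (beta_inc i j) ij)); exact: yG.
have [p plim px] := partial_thread_extends d D X f X_nonempty f_id f_exact f_surj
  X_compact X_hausdorff f_usc (codom beta) x xs.
exists p => //; apply: functional_extensionality_dep => i.
by rewrite /finite_proj px ?codom_f.
Qed.
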